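(* Let $\mathcal A$ be a wheelgebra with product $\mu=\{\mu_{n,m}\}$. The product induces a morphism of wheelspaces $\bar\mu\colon\mathcal A\to\mathcal H\mathrm{om}(\mathcal A,\mathcal A)$, given for $a\in\mathcal A(n)$ by $\bar\mu(n)(a)=\big(b\mapsto\mu_{n,m}(a,b)\big)_{m\in\mathbb N_0}$. Moreover, $\bar\mu$ is a monomorphism of wheelspaces and a morphism of wheelgebras, where $\mathcal H\mathrm{om}(\mathcal A,\mathcal A)$ carries its composition wheelgebra structure. In consequence, $\mathcal A$ is admissible.
   Context: Conventions. $k$ is a field of characteristic $0$; vector spaces, algebras and $\otimes$ are over $k$. $\mathbb N_0=\{0,1,2,\dots\}$, $\mathbb N=\{1,2,\dots\}$. $\mathbb S_n$ is the group of permutations of $\{1,\dots,n\}$ (product = composition of maps). For $\sigma\in\mathbb S_n,\tau\in\mathbb S_m$, $\sigma\oplus\tau\in\mathbb S_{n+m}$ is the block sum ($\sigma$ on the first $n$ letters, $\tau$ on the last $m$), giving $\mathbb S_n\times\mathbb S_m\subseteq\mathbb S_{n+m}$. A diagonal $\mathbb S$-bimodule is a sequence $S=(S(n))_{n\in\mathbb N_0}$ of $k\mathbb S_n$-bimodules; morphisms are sequences of bimodule maps. Wheelspaces. For $\sigma\in\mathbb S_n$ and $1\le i\le n$, $r^n_i(\sigma)\in\mathbb S_{n-1}$ is obtained from $\sigma$ by deleting $i$ from the source and $\sigma(i)$ from the target and renumbering in the order-preserving way; $l^n_j(\sigma)=(r^n_j(\sigma^{-1}))^{-1}$. A wheelspace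 is a diagonal $\mathbb S$-bimodule $S$ with linear maps (contractions) ${}^n_jt_i\colon S(n)\to S(n-1)$, $n\in\mathbb N$, $1\le i,j\le n$, such that (W1) ${}^n_jt_i(\sigma v\tau)=l^n_j(\sigma)\cdot{}^{\ \ \ \ n}_{\sigma^{-1}(j)}t_{\tau(i)}(v)\cdot r^n_i(\tau)$ for $\sigma,\tau\in\mathbb S_n$; (W2) ${}^n_jt_i\circ{}^{n+1}_{\ \ \ell}t_k={}^n_{j'}t_{i'}\circ{}^{n+1}_{\ \ \ell'}t_{k'}$, where $(i',k')=(k-1,i)$ if $i<k$ and $(k,i+1)$ if $k\le i$, and $(j',\ell')$ is obtained from $(j,\ell)$ by the same rule. Morphisms of wheelspaces are morphisms of diagonal $\mathbb S$-bimodules commuting with all contractions. Wheelgebras. A wheelgebra is a wheelspace $\mathcal A$ with linear maps $\mu_{n,m}\colon\mathcal A(n)\otimes\mathcal A(m)\to\mathcal A(n+m)$ (written $ab$) that are morphisms of $k(\mathbb S_n\times\mathbb S_m)$-bimodules, associative, with a unit $1\in\mathcal A(0)$, and compatible with contractions: ${}^{n+m}_{\ \ \ j}t_i(ab)=({}^n_jt_i a)b$ if $i,j\le n$ and $=a({}^{\ \ m}_{j-n}t_{i-n}b)$ if $i,j>n$ ($a\in\mathcal A(n)$, $b\in\mathcal A(m)$). Morphisms are morphisms of wheelspaces preserving products and units. Internal Hom. For a wheelspace $S'$ and $k\in\mathbb N_0$, $\mathrm{sh}_k(S')$ is the wheelspace with $\mathrm{sh}_k(S')(m)=S'(k+m)$,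 $\mathbb S_m$ acting on both sides through $\sigma\mapsto\mathrm{id}_k\oplus\sigma$, and contractions ${}^{k+m}_{j+k}t'_{i+k}$. $\mathcal H\mathrm{om}(S,S')$ is the wheelspace with $\mathcal H\mathrm{om}(S,S')(n)=\mathrm{Hom}_{\text{wheelspaces}}(S,\mathrm{sh}_n(S'))$ (families $f=(f(m)\colon S(m)\to S'(n+m))_m$), $\mathbb S_n$-actions $(\sigma' f\sigma)(v)=(\sigma'\oplus\mathrm{id})\cdot f(v)\cdot(\sigma\oplus\mathrm{id})$ and contractions $({}^n_jT_if)(m)={}^{n+m}_{\ \ \ j}t'_i\circ f(m)$. $\mathcal H\mathrm{om}(S,S)$ is a wheelgebra with product $(fg)(m')=f(m+m')\circ g(m')$ for $f\in\mathcal H\mathrm{om}(S,S)(n)$, $g\in\mathcal H\mathrm{om}(S,S)(m)$, and unit $\mathrm{id}_S$ in weight $0$. Admissibility. A wheelgebra $\mathcal A$ is admissible if the map ${}^2_2t_1\circ\mu_{1,1}\colon\mathcal A(1)\otimes\mathcal A(1)\to\mathcal A(1)$ turns $\mathcal A(1)$ into an associative (not necessarily unital) algebra. *)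

(* Defs.v *)
From HB Require Import structures.
From mathcomp Require Import all_boot all_order all_fingroup all_algebra.
From mathcomp Require Import boolp.

Set Implicit Arguments.
Unset Strict Implicit.
Unset Printing Implicit Defensive.

Import GRing.Theory.
Local Open Scope ring_scope.

(* Letters are numbered from 0: the letters of S_n are the elements of 'I_n. *)

(* The product of 'S_n in the library is diagrammatic: (s * t)%g is "s, then
   t".  [pcomp s t] is the composite of maps s o t. *)
Definition pcomp n (s t : 'S_n) : 'S_n := (t * s)%g.

Lemma pcompE n (s t : 'S_n) x : pcomp s t x = s (t x).
Proof. by rewrite /pcomp permM. Qed.

Definition bsum_fun n m (s : 'S_n) (t : 'S_m) (x : 'I_(n + m)) : 'I_(n + m) :=
  match split x with
  | inl i => lshift m (s i)
  | inr j => rshift n (t j)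
  end.

Lemma bsum_fun_inj n m (s : 'S_n) (t : 'S_m) : injective (bsum_fun s t).
Proof.
apply: (@can_inj _ _ _ (bsum_fun s^-1%g t^-1%g)) => x; rewrite /bsum_fun.
case: (split_ordP x) => i ->.
  by rewrite (unsplitK (inl _)) permK.
by rewrite (unsplitK (inr _)) permK.
Qed.

Definition bsum n m (s : 'S_n) (t : 'S_m) : 'S_(n + m) :=
  perm (@bsum_fun_inj n m s t).

Lemma rdel_subproof n (i : 'I_n.+1) (s : 'S_n.+1) :
  injective (fun x : 'I_n => odflt x (unlift (s i) (s (lift i x)))).
Proof.
have sD x : s i != s (lift i x) by rewrite (inj_eq perm_inj) neq_lift.
move=> x y /=.
case: (unlift_some (sD x)) => a Ea ->; case: (unlift_some (sD y)) => b Eb -> /= ab.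
by apply: (@lift_inj _ i); apply: (@perm_inj _ s); rewrite Ea Eb ab.
Qed.

(* r_i(s): delete i from the source and s i from the target, renumbering both
   increasingly; the default value of [odflt] is never used (see [rdelP]). *)
Definition rdel n (i : 'I_n.+1) (s : 'S_n.+1) : 'S_n :=
  perm (@rdel_subproof n i s).

Definition ldel n (j : 'I_n.+1) (s : 'S_n.+1) : 'S_n := (rdel j s^-1%g)^-1%g.

Lemma rdelP n (i : 'I_n.+1) (s : 'S_n.+1) x :
  lift (s i) (rdel i s x) = s (lift i x).
Proof.
have sD : s i != s (lift i x) by rewrite (inj_eq perm_inj) neq_lift.
by rewrite permE; case: (unlift_some sD) => a Ea ->.
Qed.

(* [exch i h] is the pair (i', h') such that contracting the position h and
   then i is contracting h' and then i'. *)
Definition exch n (i : 'I_n.+1) (h : 'I_n.+2) : 'I_n.+1 * 'I_n.+2 :=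
  if (i < h)%N then (inord h.-1, inord i) else (inord h, inord i.+1).

Section Structures.
Variable k : fieldType.

(* A bimodule over the group algebra of S_n is a k-module with commuting
   linear left and right actions of S_n. *)
Record dbimodule := DBimodule {
  dcar :> nat -> lmodType k;
  lact : forall n, 'S_n -> dcar n -> dcar n;
  ract : forall n, dcar n -> 'S_n -> dcar n;
  lact_linear : forall n (s : 'S_n), linear (lact s);
  ract_linear : forall n (s : 'S_n), linear (fun v => ract v s);
  lact1 : forall n (v : dcar n), lact 1%g v = v;
  ract1 : forall n (v : dcar n), ract v 1%g = v;
  lactM : forall n (s t : 'S_n) v, lact (pcomp s t) v = lact s (lact t v);
  ractM : forall n (s t : 'S_n) v, ract v (pcomp s t) = ract (ract v s) t;
  lractA : forall n (s t : 'S_n) v, lact s (ract v t) = ract (lact s v) t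
}.

Definition wcast (S : dbimodule) n m (e : n = m) (v : S n) : S m :=
  ecast p (S p) e v.

(* [ctr j i] contracts the output j with the input i. *)
Record wheelspace := Wheelspace {
  wbim :> dbimodule;
  ctr : forall n, 'I_n.+1 -> 'I_n.+1 -> wbim n.+1 -> wbim n;
  ctr_linear : forall n (j i : 'I_n.+1), linear (ctr j i);
  ctr_act : forall n (j i : 'I_n.+1) (s t : 'S_n.+1) v,
    ctr j i (lact s (ract v t)) =
      lact (ldel j s) (ract (ctr (s^-1%g j) (t i) v) (rdel i t));
  ctr_ctr : forall n (j i : 'I_n.+1) (l h : 'I_n.+2) v,
    ctr j i (ctr l h v) =
      ctr (exch j l).1 (exch i h).1 (ctr (exch j l).2 (exch i h).2 v)
}.

Record whom (S S' : wheelspace) := Whom {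
  wmap :> forall n, S n -> S' n;
  wmap_linear : forall n, linear (@wmap n);
  wmap_lact : forall n (s : 'S_n) v, wmap (lact s v) = lact s (wmap v);
  wmap_ract : forall n (s : 'S_n) v, wmap (ract v s) = ract (wmap v) s;
  wmap_ctr : forall n (j i : 'I_n.+1) v, wmap (ctr j i v) = ctr j i (wmap v)
}.

(* Linear maps out of the tensor product of A n and A m are given as bilinear
   maps.  The casts identify A (n + (m + p)) with A (n + m + p), A (n + 0) with
   A n and A (n + m.+1) with A (n + m).+1. *)
Record wheelgebra := Wheelgebra {
  wspc :> wheelspace;
  wmul : forall n m, wspc n -> wspc m -> wspc (n + m)%N;
  wone : wspc 0%N;
  wmul_linearl : forall n m (b : wspc m), linear (fun a : wspc n => wmul a b);
  wmul_linearr : forall n m (a : wspc n), linear (fun b : wspc m => wmul a b);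
  wmul_lact : forall n m (s : 'S_n) (t : 'S_m) a b,
    wmul (lact s a) (lact t b) = lact (bsum s t) (wmul a b);
  wmul_ract : forall n m (s : 'S_n) (t : 'S_m) a b,
    wmul (ract a s) (ract b t) = ract (wmul a b) (bsum s t);
  wmulA : forall n m p (a : wspc n) (b : wspc m) (c : wspc p),
    wcast (addnA n m p) (wmul a (wmul b c)) = wmul (wmul a b) c;
  wmul1l : forall n (a : wspc n), wmul wone a = a;
  wmul1r : forall n (a : wspc n), wcast (addn0 n) (wmul a wone) = a;
  ctr_wmull : forall n m (j i : 'I_n.+1) (a : wspc n.+1) (b : wspc m),
    @ctr wspc (n + m)%N (lshift m j) (lshift m i) (wmul a b) =
      wmul (ctr j i a) b;
  ctr_wmulr : forall n m (j i : 'I_m.+1) (a : wspc n) (b : wspc m.+1),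
    @ctr wspc (n + m)%N (cast_ord (addnS n m) (rshift n j))
        (cast_ord (addnS n m) (rshift n i)) (wcast (addnS n m) (wmul a b)) =
      wmul a (ctr j i b)
}.

Definition is_wheelgebra_morphism (A B : wheelgebra) (f : whom A B) : Prop :=
  (forall n m (a : A n) (b : A m), f _ (wmul a b) = wmul (f _ a) (f _ b)) /\
  f _ (wone A) = wone B.

(* The second output is contracted with the first input; the operation is
   bilinear by construction. *)
Definition admissible (A : wheelgebra) : Prop :=
  associative (fun a b : A 1%N => @ctr A 1%N (lift ord0 ord0) ord0 (wmul a b)).

End Structures.

Section Category.
Variable k : fieldType.
Implicit Types S T U : wheelspace k.

Lemma whomP S T (f g : whom S T) : (forall n v, f n v = g n v) -> f = g.
Proof.
case: f g => f f1 f2 f3 f4 [g g1 g2 g3 g4] /= fg.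
have E : f = g by apply: functional_extensionality_dep => n; apply/funext => v.
by case: _ / E in g1 g2 g3 g4 *; congr Whom; apply: Prop_irrelevance.
Qed.

Program Definition wcomp S T U (g : whom T U) (f : whom S T) : whom S U :=
  @Whom k S U (fun n v => g n (f n v)) _ _ _ _.
Next Obligation. by move=> a u v; rewrite !wmap_linear. Qed.
Next Obligation. by move=> *; rewrite !wmap_lact. Qed.
Next Obligation. by move=> *; rewrite !wmap_ract. Qed.
Next Obligation. by move=> *; rewrite !wmap_ctr. Qed.

Program Definition wid S : whom S S := @Whom k S S (fun _ v => v) _ _ _ _.
Solve All Obligations with by [].

Definition wmono S T (h : whom S T) : Prop :=
  forall (U : wheelspace k) (f g : whom U S), wcomp h f = wcomp h g -> f = g.

End Category.

Section Casts.
Variables (k : fieldType) (S : wheelspace k).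

Lemma wcast_id n (e : n = n) (v : S n) : wcast e v = v.
Proof. by rewrite (eq_axiomK e). Qed.

Lemma wcast_trans n m p (e : n = m) (e' : m = p) (e'' : n = p) (v : S n) :
  wcast e' (wcast e v) = wcast e'' v.
Proof. by case: _ / e' in e'' *; rewrite wcast_id (eq_irrelevance e e''). Qed.

Lemma wcast_linear n m (e : n = m) : linear (wcast e : S n -> S m).
Proof. by move=> a u v; case: _ / e; rewrite !wcast_id. Qed.

Lemma wcast_lact n m (e : n = m) s (v : S n) :
  wcast e (lact s v) = lact (cast_perm e s) (wcast e v).
Proof. by case: _ / e; rewrite !wcast_id cast_perm_id. Qed.

Lemma wcast_ract n m (e : n = m) s (v : S n) :
  wcast e (ract v s) = ract (wcast e v) (cast_perm e s).
Proof. by case: _ / e; rewrite !wcast_id cast_perm_id. Qed.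

Lemma wcast_ctr n m (e : n.+1 = m.+1) (e' : n = m) j i (v : S n.+1) :
  ctr (cast_ord e j) (cast_ord e i) (wcast e v) = wcast e' (ctr j i v).
Proof. by case: _ / e' in e *; rewrite !wcast_id !cast_ord_id. Qed.

End Casts.

Section PermLemmas.

Lemma bsuml n m (s : 'S_n) (t : 'S_m) i : bsum s t (lshift m i) = lshift m (s i).
Proof. by rewrite permE /bsum_fun (unsplitK (inl _)). Qed.

Lemma bsumr n m (s : 'S_n) (t : 'S_m) i : bsum s t (rshift n i) = rshift n (t i).
Proof. by rewrite permE /bsum_fun (unsplitK (inr _)). Qed.

Lemma bsumV n m (s : 'S_n) (t : 'S_m) : (bsum s t)^-1%g = bsum s^-1%g t^-1%g.
Proof.
apply/eqP; rewrite eq_invg_mul; apply/eqP/permP => x; rewrite permM perm1.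
by case: (split_ordP x) => i ->; rewrite ?(bsuml, bsumr) permK.
Qed.

Lemma bsum1 n m : bsum (1%g : 'S_n) (1%g : 'S_m) = 1%g.
Proof.
by apply/permP => x; rewrite perm1; case: (split_ordP x) => i ->;
  rewrite ?(bsuml, bsumr) perm1.
Qed.

Lemma bsum_comp n m (s s' : 'S_n) (t t' : 'S_m) :
  pcomp (bsum s t) (bsum s' t') = bsum (pcomp s s') (pcomp t t').
Proof.
by apply/permP => x; rewrite pcompE; case: (split_ordP x) => i ->;
  rewrite ?(bsuml, bsumr) pcompE.
Qed.

Lemma bsumA n m p (s : 'S_n) (t : 'S_m) (u : 'S_p) :
  cast_perm (addnA n m p) (bsum s (bsum t u)) = bsum (bsum s t) u.
Proof.
apply/permP => x; apply: val_inj; rewrite cast_permE /=.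
have [y ->] : exists y, x = cast_ord (addnA n m p) y.
  by exists (cast_ord (esym (addnA n m p)) x); rewrite cast_ordKV.
rewrite cast_ordK; case: (split_ordP y) => i ->.
  rewrite bsuml (_ : cast_ord _ _ = lshift p (lshift m i)) ?bsuml //.
  exact: val_inj.
case: (split_ordP i) => j ->.
  rewrite bsumr bsuml (_ : cast_ord _ _ = lshift p (rshift n j)) ?bsuml ?bsumr //.
  exact: val_inj.
rewrite !bsumr (_ : cast_ord _ _ = rshift (n + m) j) ?bsumr /= ?addnA //.
by apply: val_inj; rewrite /= addnA.
Qed.

Lemma bsum0l m (t : 'S_m) : bsum (1%g : 'S_0) t = t.
Proof.
apply/permP => x; case: (split_ordP x) => [[] //|i ->]; rewrite bsumr.
by apply: val_inj; congr (val (t _)); apply: val_inj.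
Qed.

Lemma rdelU n i (s : 'S_n.+1) (u : 'S_n) :
  (forall x, val (lift (s i) (u x)) = val (s (lift i x))) -> rdel i s = u.
Proof.
move=> su; apply/permP => x; apply: (@lift_inj _ (s i)).
by rewrite rdelP; apply/esym/val_inj/su.
Qed.

Lemma rdel1 n (i : 'I_n.+1) : rdel i 1%g = 1%g.
Proof. by apply: rdelU => x; rewrite !perm1. Qed.

Lemma ldel1 n (i : 'I_n.+1) : ldel i 1%g = 1%g.
Proof. by rewrite /ldel invg1 rdel1 invg1. Qed.

Lemma rdel_bsuml n m (i : 'I_n.+1) (s : 'S_n.+1) (t : 'S_m) :
  @rdel (n + m) (lshift m i) (bsum s t) = bsum (rdel i s) t.
Proof.
apply: rdelU => x; rewrite (bsuml s t).
have L (a : 'I_n.+1) (b : 'I_n) :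
    @lift (n + m).+1 (lshift m a) (lshift m b) = lshift m (lift a b).
  by apply: val_inj.
have R (a : 'I_n.+1) (b : 'I_m) :
    @lift (n + m).+1 (lshift m a) (rshift n b) = rshift n.+1 b.
  apply: val_inj; rewrite /= /bump (leq_trans _ (leq_addr _ _)) ?addSn //.
  by rewrite -ltnS ltn_ord.
by case: (split_ordP x) => y ->;
  rewrite ?(bsuml, bsumr) ?(L, R) ?(bsuml s, bsumr s) -?rdelP.
Qed.

Lemma rdel_bsumr n m i (s : 'S_n) (t : 'S_m.+1) :
  rdel (cast_ord (addnS n m) (rshift n i)) (cast_perm (addnS n m) (bsum s t)) =
  bsum s (rdel i t).
Proof.
apply: rdelU => x; rewrite -cast_ord_permE bsumr.
have L (a : 'I_m.+1) (b : 'I_n) :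
    lift (cast_ord (addnS n m) (rshift n a)) (lshift m b) =
    cast_ord (addnS n m) (lshift m.+1 b).
  apply: val_inj; rewrite /= /bump leqNgt (leq_trans (ltn_ord b)) //.
  exact: leq_addr.
have R (a : 'I_m.+1) (b : 'I_m) :
    lift (cast_ord (addnS n m) (rshift n a)) (rshift n b) =
    cast_ord (addnS n m) (rshift n (lift a b)).
  by apply: val_inj; rewrite /= bumpDl.
by case: (split_ordP x) => y ->;
  rewrite ?(bsuml, bsumr) ?(L, R) -?cast_ord_permE ?(bsuml, bsumr) -?rdelP.
Qed.

Lemma cast_permV n m (e : n = m) (s : 'S_n) :
  (cast_perm e s)^-1%g = cast_perm e s^-1%g.
Proof. by case: _ / e; rewrite !cast_perm_id. Qed.

Lemma ldel_bsuml n m (i : 'I_n.+1) (s : 'S_n.+1) (t : 'S_m) :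
  @ldel (n + m) (lshift m i) (bsum s t) = bsum (ldel i s) t.
Proof. by rewrite /ldel (bsumV s) (rdel_bsuml i) bsumV invgK. Qed.

Lemma ldel_bsumr n m i (s : 'S_n) (t : 'S_m.+1) :
  ldel (cast_ord (addnS n m) (rshift n i)) (cast_perm (addnS n m) (bsum s t)) =
  bsum s (ldel i t).
Proof. by rewrite /ldel cast_permV bsumV rdel_bsumr bsumV invgK. Qed.

End PermLemmas.

Section CtrAct.
Variables (k : fieldType) (S : wheelspace k) (n : nat).

Lemma ctr_lact (j i : 'I_n.+1) s (v : S n.+1) :
  ctr j i (lact s v) = lact (ldel j s) (ctr (s^-1%g j) i v).
Proof. by have := ctr_act j i s 1%g v; rewrite perm1 rdel1 !ract1. Qed.

Lemma ctr_ract (j i : 'I_n.+1) s (v : S n.+1) :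
  ctr j i (ract v s) = ract (ctr j (s i) v) (rdel i s).
Proof. by have := ctr_act j i 1%g s v; rewrite invg1 perm1 ldel1 !lact1. Qed.

End CtrAct.

Section Linear.
Variables (k : fieldType) (U V : lmodType k) (f : U -> V).
Hypothesis f_linear : linear f.

Lemma lin_D u v : f (u + v) = f u + f v.
Proof. by have := f_linear 1 u v; rewrite !scale1r. Qed.

Lemma lin_0 : f 0 = 0.
Proof. by apply: (addrI (f 0)); rewrite -lin_D !addr0. Qed.

Lemma lin_Z a u : f (a *: u) = a *: f u.
Proof. by have := f_linear a u 0; rewrite lin_0 !addr0. Qed.

Lemma lin_N u : f (- u) = - f u.
Proof. by rewrite -scaleN1r lin_Z scaleN1r. Qed.

End Linear.

Section HomModule.
Variables (k : fieldType) (S S' : wheelspace k).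
Implicit Types f g h : whom S S'.

HB.instance Definition _ := gen_eqMixin (whom S S').
HB.instance Definition _ := gen_choiceMixin (whom S S').

Program Definition whom_zero : whom S S' := @Whom k S S' (fun _ _ => 0) _ _ _ _.
Next Obligation. by move=> a u v; rewrite scaler0 addr0. Qed.
Next Obligation. by move=> *; rewrite (lin_0 (lact_linear s)). Qed.
Next Obligation. by move=> *; rewrite (lin_0 (ract_linear s)). Qed.
Next Obligation. by move=> *; rewrite (lin_0 (ctr_linear j i)). Qed.

Program Definition whom_add f g : whom S S' :=
  @Whom k S S' (fun n v => f n v + g n v) _ _ _ _.
Next Obligation.
by move=> a u v; rewrite !wmap_linear scalerDr !addrA; congr (_ + _); rewrite addrAC.
Qed.
Next Obligation. by move=> *; rewrite (lin_D (lact_linear s)) !wmap_lact. Qed.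
Next Obligation. by move=> *; rewrite (lin_D (ract_linear s)) !wmap_ract. Qed.
Next Obligation. by move=> *; rewrite (lin_D (ctr_linear j i)) !wmap_ctr. Qed.

Program Definition whom_opp f : whom S S' :=
  @Whom k S S' (fun n v => - f n v) _ _ _ _.
Next Obligation. by move=> a u v; rewrite !wmap_linear scalerN opprD. Qed.
Next Obligation. by move=> *; rewrite (lin_N (lact_linear s)) !wmap_lact. Qed.
Next Obligation. by move=> *; rewrite (lin_N (ract_linear s)) !wmap_ract. Qed.
Next Obligation. by move=> *; rewrite (lin_N (ctr_linear j i)) !wmap_ctr. Qed.

Program Definition whom_scale (a : k) f : whom S S' :=
  @Whom k S S' (fun n v => a *: f n v) _ _ _ _.
Next Obligation.
by move=> b u v; rewrite !wmap_linear scalerDr !scalerA mulrC.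
Qed.
Next Obligation. by move=> *; rewrite (lin_Z (lact_linear s)) !wmap_lact. Qed.
Next Obligation. by move=> *; rewrite (lin_Z (ract_linear s)) !wmap_ract. Qed.
Next Obligation. by move=> *; rewrite (lin_Z (ctr_linear j i)) !wmap_ctr. Qed.

Fact whom_addA : associative whom_add.
Proof. by move=> f g h; apply: whomP => n v /=; rewrite addrA. Qed.
Fact whom_addC : commutative whom_add.
Proof. by move=> f g; apply: whomP => n v /=; rewrite addrC. Qed.
Fact whom_add0 : left_id whom_zero whom_add.
Proof. by move=> f; apply: whomP => n v /=; rewrite add0r. Qed.
Fact whom_addN : left_inverse whom_zero whom_opp whom_add.
Proof. by move=> f; apply: whomP => n v /=; rewrite addNr. Qed.

HB.instance Definition _ := GRing.isZmodule.Build (whom S S')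
  whom_addA whom_addC whom_add0 whom_addN.

Fact whom_scaleA a b f : whom_scale a (whom_scale b f) = whom_scale (a * b) f.
Proof. by apply: whomP => n v /=; rewrite scalerA. Qed.
Fact whom_scale1 : left_id 1 whom_scale.
Proof. by move=> f; apply: whomP => n v /=; rewrite scale1r. Qed.
Fact whom_scaleDr : right_distributive whom_scale +%R.
Proof. by move=> a f g; apply: whomP => n v /=; rewrite scalerDr. Qed.
Fact whom_scaleDl f : {morph whom_scale^~ f : a b / a + b}.
Proof. by move=> a b; apply: whomP => n v /=; rewrite scalerDl. Qed.

HB.instance Definition _ := GRing.Zmodule_isLmodule.Build k (whom S S')
  whom_scaleA whom_scale1 whom_scaleDr whom_scaleDl.

End HomModule.

Section Exch.

Lemma exchE1 n (i : 'I_n.+1) (h : 'I_n.+2) :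
  (exch i h).1 = (if (i < h)%N then h.-1 else h) :> nat.
Proof.
rewrite /exch; case: ltnP => ih /=; rewrite inordK //.
  by case: (nat_of_ord h) (ltn_ord h) ih.
exact: leq_ltn_trans ih (ltn_ord i).
Qed.

Lemma exchE2 n (i : 'I_n.+1) (h : 'I_n.+2) :
  (exch i h).2 = (if (i < h)%N then i : nat else i.+1) :> nat.
Proof.
rewrite /exch; have i_lt : (i < n.+2)%N by apply: leq_trans (ltn_ord i) _.
by case: ltnP => ih /=; rewrite inordK // ltnS.
Qed.

Lemma exch_shift k n (e1 : (k + n.+1 = (k + n).+1)%N)
    (e2 : (k + n.+2 = (k + n).+2)%N) (i : 'I_n.+1) (h : 'I_n.+2) :
  exch (cast_ord e1 (rshift k i)) (cast_ord e2 (rshift k h)) =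
  (cast_ord e1 (rshift k (exch i h).1), cast_ord e2 (rshift k (exch i h).2)).
Proof.
rewrite [LHS]surjective_pairing; congr pair; apply: val_inj.
  rewrite [LHS]exchE1 /= ltn_add2l exchE1; case: ltnP => //.
  by case: (nat_of_ord h) => // h' _; rewrite addnS.
by rewrite [LHS]exchE2 /= ltn_add2l exchE2; case: ltnP => //; rewrite addnS.
Qed.

Lemma exch_lshift n m (i : 'I_n.+1) (h : 'I_n.+2) :
  @exch (n + m) (lshift m i) (lshift m h) =
  (lshift m (exch i h).1, lshift m (exch i h).2).
Proof.
rewrite [LHS]surjective_pairing; congr pair; apply: val_inj.
  by rewrite [LHS]exchE1 /= exchE1.
by rewrite [LHS]exchE2 /= exchE2.
Qed.

Lemma exch_lr n m (e1 : (n + m.+1 = (n + m).+1)%N)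
    (e2 : (n.+1 + m.+1 = (n + m).+2)%N) (i : 'I_n.+1) (h : 'I_m.+1) :
  @exch (n + m) (lshift m i) (cast_ord e2 (rshift n.+1 h)) =
  (cast_ord e1 (rshift n h), cast_ord e2 (lshift m.+1 i)).
Proof.
have ih : (i < n.+1 + h)%N by apply: leq_trans (ltn_ord i) (leq_addr _ _).
rewrite [LHS]surjective_pairing; congr pair; apply: val_inj.
  by rewrite [LHS]exchE1 /= ih.
by rewrite [LHS]exchE2 /= ih.
Qed.

End Exch.

Section Shift.
Variables (k : fieldType) (p : nat) (S : wheelspace k).

Program Definition sh_bim : dbimodule k :=
  @DBimodule k (fun m => S (p + m)%N)
    (fun m s v => lact (bsum 1%g s) v)
    (fun m v s => ract v (bsum 1%g s)) _ _ _ _ _ _ _.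
Next Obligation. by move=> a u v; rewrite lact_linear. Qed.
Next Obligation. by move=> a u v; rewrite ract_linear. Qed.
Next Obligation. by move=> *; rewrite bsum1 lact1. Qed.
Next Obligation. by move=> *; rewrite bsum1 ract1. Qed.
Next Obligation. by move=> *; rewrite -lactM bsum_comp /pcomp mulg1. Qed.
Next Obligation. by move=> *; rewrite -ractM bsum_comp /pcomp mulg1. Qed.
Next Obligation. by move=> *; rewrite lractA. Qed.

Definition sh_ctr m (j i : 'I_m.+1) (v : sh_bim m.+1) : sh_bim m :=
  @ctr k S (p + m)%N (cast_ord (addnS p m) (rshift p j))
    (cast_ord (addnS p m) (rshift p i))
    (wcast (addnS p m) (v : S (p + m.+1)%N)).

Fact sh_ctr_linear m (j i : 'I_m.+1) : linear (sh_ctr j i).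
Proof. by move=> a u v; rewrite /sh_ctr wcast_linear ctr_linear. Qed.

Fact sh_ctr_act m (j i : 'I_m.+1) (s t : 'S_m.+1) (v : sh_bim m.+1) :
  sh_ctr j i (lact s (ract v t)) =
  lact (ldel j s) (ract (sh_ctr (s^-1%g j) (t i) v) (rdel i t)).
Proof.
rewrite /sh_ctr /= wcast_lact wcast_ract ctr_act ldel_bsumr rdel_bsumr.
by rewrite cast_permV -!cast_ord_permE bsumV !bsumr.
Qed.

Fact sh_ctr_ctr m (j i : 'I_m.+1) (l h : 'I_m.+2) (v : sh_bim m.+2) :
  sh_ctr j i (sh_ctr l h v) =
  sh_ctr (exch j l).1 (exch i h).1 (sh_ctr (exch j l).2 (exch i h).2 v).
Proof.
have e2 : (p + m.+2 = (p + m).+2)%N by rewrite !addnS.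
have C (a b : 'I_m.+1) (c d : 'I_m.+2) : sh_ctr a b (sh_ctr c d v) =
    @ctr k S (p + m)%N (cast_ord (addnS p m) (rshift p a))
      (cast_ord (addnS p m) (rshift p b))
      (ctr (cast_ord e2 (rshift p c)) (cast_ord e2 (rshift p d))
         (wcast e2 (v : S (p + m.+2)%N))).
  rewrite /sh_ctr -(wcast_ctr (congr1 succn (addnS p m))).
  rewrite (wcast_trans _ _ e2).
  by congr (ctr _ _ (ctr _ _ _)); apply: val_inj.
by rewrite !C ctr_ctr !exch_shift.
Qed.

Definition sh : wheelspace k :=
  Wheelspace sh_ctr_linear sh_ctr_act sh_ctr_ctr.

End Shift.

Section InternalHom.
Variables (k : fieldType) (S S' : wheelspace k).

Section Actions.
Variables (n : nat) (s : 'S_n) (f : whom S (sh n S')).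

Program Definition ihom_lact : whom S (sh n S') :=
  @Whom k S (sh n S')
    (fun m v => lact (bsum s (1%g : 'S_m)) (f m v : S' (n + m)%N)) _ _ _ _.
Next Obligation. by move=> a u v; rewrite wmap_linear lact_linear. Qed.
Next Obligation.
by move=> *; rewrite wmap_lact /= -!lactM !bsum_comp /pcomp !mulg1 !mul1g.
Qed.
Next Obligation. by move=> *; rewrite wmap_ract /= lractA. Qed.
Next Obligation.
rewrite wmap_ctr /= /sh_ctr wcast_lact ctr_lact ldel_bsumr cast_permV.
by rewrite -cast_ord_permE bsumV bsumr invg1 perm1 ldel1.
Qed.

Program Definition ihom_ract : whom S (sh n S') :=
  @Whom k S (sh n S')
    (fun m v => ract (f m v : S' (n + m)%N) (bsum s (1%g : 'S_m))) _ _ _ _.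
Next Obligation. by move=> a u v; rewrite wmap_linear ract_linear. Qed.
Next Obligation. by move=> *; rewrite wmap_lact /= lractA. Qed.
Next Obligation.
by move=> *; rewrite wmap_ract /= -!ractM !bsum_comp /pcomp !mulg1 !mul1g.
Qed.
Next Obligation.
rewrite wmap_ctr /= /sh_ctr wcast_ract ctr_ract rdel_bsumr.
by rewrite -cast_ord_permE bsumr perm1 rdel1.
Qed.

End Actions.

Program Definition ihom_bim : dbimodule k :=
  @DBimodule k (fun n => whom S (sh n S') : lmodType k)
    (fun n s f => ihom_lact s f) (fun n f s => ihom_ract s f) _ _ _ _ _ _ _.
Next Obligation. by move=> a f g; apply: whomP => m x /=; rewrite lact_linear. Qed.
Next Obligation. by move=> a f g; apply: whomP => m x /=; rewrite ract_linear. Qed.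
Next Obligation. by apply: whomP => m x /=; rewrite bsum1 lact1. Qed.
Next Obligation. by apply: whomP => m x /=; rewrite bsum1 ract1. Qed.
Next Obligation.
by apply: whomP => m x /=; rewrite -lactM bsum_comp /pcomp mulg1.
Qed.
Next Obligation.
by apply: whomP => m x /=; rewrite -ractM bsum_comp /pcomp mulg1.
Qed.
Next Obligation. by apply: whomP => m x /=; rewrite lractA. Qed.

Program Definition ihom_ctr n (j i : 'I_n.+1) (f : ihom_bim n.+1) : ihom_bim n :=
  @Whom k S (sh n S')
    (fun m v => @ctr k S' (n + m)%N (lshift m j) (lshift m i)
       (wmap (f : whom S (sh n.+1 S')) v : S' (n.+1 + m)%N)) _ _ _ _.
Next Obligation. by move=> a u v; rewrite wmap_linear ctr_linear. Qed.
Next Obligation.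
rewrite wmap_lact /= (ctr_lact (n := (n + _)%N)) (ldel_bsuml j).
by rewrite ldel1 (bsumV (1%g : 'S_n.+1)) (bsuml _ _ j) invg1 perm1.
Qed.
Next Obligation.
rewrite wmap_ract /= (ctr_ract (n := (n + _)%N)) (rdel_bsuml i).
by rewrite rdel1 (bsuml _ _ i) perm1.
Qed.
Next Obligation.
rewrite wmap_ctr /= /sh_ctr -(wcast_ctr (addnS n.+1 _)) (ctr_ctr (n := (n + _)%N)).
by rewrite !(exch_lr (addnS n _)).
Qed.

Fact ihom_ctr_linear n (j i : 'I_n.+1) : linear (ihom_ctr j i).
Proof. by move=> a f g; apply: whomP => m v /=; rewrite (ctr_linear (n := (n + m)%N)). Qed.

Fact ihom_ctr_act n (j i : 'I_n.+1) (s t : 'S_n.+1) (f : ihom_bim n.+1) :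
  ihom_ctr j i (lact s (ract f t)) =
  lact (ldel j s) (ract (ihom_ctr (s^-1%g j) (t i) f) (rdel i t)).
Proof.
apply: whomP => m v /=; rewrite (ctr_act (n := (n + m)%N)) (ldel_bsuml j).
by rewrite (rdel_bsuml i) (bsumV s) (bsuml _ _ j) (bsuml t).
Qed.

Fact ihom_ctr_ctr n (j i : 'I_n.+1) (l h : 'I_n.+2) (f : ihom_bim n.+2) :
  ihom_ctr j i (ihom_ctr l h f) =
  ihom_ctr (exch j l).1 (exch i h).1 (ihom_ctr (exch j l).2 (exch i h).2 f).
Proof.
by apply: whomP => m v /=; rewrite (ctr_ctr (n := (n + m)%N)) !exch_lshift.
Qed.

Definition ihom : wheelspace k :=
  Wheelspace ihom_ctr_linear ihom_ctr_act ihom_ctr_ctr.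

End InternalHom.

Lemma sh_wcast (k : fieldType) (S T : wheelspace k) p (f : whom S (sh p T)) n m
    (e : n = m) (v : S n) :
  f m (wcast e v) = wcast (congr1 (addn p) e) (f n v : T (p + n)%N).
Proof. by case: _ / e; rewrite wcast_id. Qed.

Lemma ihom_wcast (k : fieldType) (S T : wheelspace k) n m (e : n = m)
    (f : ihom S T n) p (v : S p) :
  wmap (wcast e f : whom S (sh m T)) v =
  wcast (congr1 (addn^~ p) e) (wmap (f : whom S (sh n T)) v : T (n + p)%N).
Proof. by case: _ / e; rewrite !wcast_id. Qed.

Section InternalEnd.
Variables (k : fieldType) (S : wheelspace k).

Program Definition iend_mul n m (f : ihom S S n) (g : ihom S S m) :
    ihom S S (n + m)%N :=
  @Whom k S (sh (n + m) S)
    (fun p v => wcast (addnA n m p)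
       (wmap (f : whom S (sh n S))
          (wmap (g : whom S (sh m S)) v : S (m + p)%N) : S (n + (m + p))%N))
    _ _ _ _.
Next Obligation.
by move=> a u v; rewrite (wmap_linear g) (wmap_linear f) wcast_linear.
Qed.
Next Obligation.
by rewrite wmap_lact /= (wmap_lact f) /= wcast_lact bsumA bsum1.
Qed.
Next Obligation.
by rewrite wmap_ract /= (wmap_ract f) /= wcast_ract bsumA bsum1.
Qed.
Next Obligation.
rewrite wmap_ctr /= /sh_ctr (wmap_ctr f) /= /sh_ctr sh_wcast.
have e : ((n + (m + n0)).+1 = (n + m + n0).+1)%N by rewrite addnA.
have e1 : (n + (m + n0.+1) = (n + m + n0).+1)%N by rewrite addnA addnS.
rewrite -(wcast_ctr e) !(wcast_trans _ _ e1).
have e2 : (n + (m + n0).+1 = (n + m + n0).+1)%N by rewrite addnS addnA.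
rewrite (wcast_trans _ _ e2) (wcast_trans _ _ e1).
by congr (ctr _ _ _); apply: val_inj; rewrite /= addnA.
Qed.

Program Definition iend_one : ihom S S 0%N :=
  @Whom k S (sh 0 S) (fun _ v => v) _ _ _ _.
Next Obligation. by []. Qed.
Next Obligation. by rewrite /= bsum0l. Qed.
Next Obligation. by rewrite /= bsum0l. Qed.
Next Obligation.
by rewrite /sh_ctr wcast_id; congr (ctr _ _ _); apply: val_inj.
Qed.

Program Definition iend : wheelgebra k :=
  @Wheelgebra k (ihom S S) iend_mul iend_one _ _ _ _ _ _ _ _ _.
Next Obligation.
by move=> a f g; apply: whomP => p v /=; rewrite wcast_linear.
Qed.
Next Obligation.
by move=> c f g; apply: whomP => p v /=; rewrite (wmap_linear a) wcast_linear.
Qed.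
Next Obligation.
apply: whomP => p v /=; rewrite (wmap_lact a) /= -lactM bsum_comp.
by rewrite /pcomp mulg1 mul1g wcast_lact bsumA.
Qed.
Next Obligation.
apply: whomP => p v /=; rewrite (wmap_ract a) /= -ractM bsum_comp.
by rewrite /pcomp mulg1 mul1g wcast_ract bsumA.
Qed.
Next Obligation.
apply: whomP => q v; rewrite ihom_wcast /= (sh_wcast a).
have e : (n + (m + (p + q)) = n + m + p + q)%N by rewrite !addnA.
have e1 : (n + (m + p + q) = n + m + p + q)%N by rewrite !addnA.
by rewrite !(wcast_trans _ _ e1) !(wcast_trans _ _ e).
Qed.
Next Obligation. by apply: whomP => p v /=; rewrite wcast_id. Qed.
Next Obligation.
apply: whomP => p v; rewrite ihom_wcast /= (wcast_trans _ _ (erefl (n + p)%N)).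
by rewrite wcast_id.
Qed.
Next Obligation.
apply: whomP => p v /=; rewrite -(wcast_ctr (addnA n.+1 m p)).
by congr (ctr _ _ _); apply: val_inj.
Qed.
Next Obligation.
apply: whomP => p v; rewrite /= ihom_wcast /= (wmap_ctr a) /= /sh_ctr.
have e : (n + (m.+1 + p) = (n + m + p).+1)%N by rewrite addnS addnA.
have e1 : ((n + (m + p)).+1 = (n + m + p).+1)%N by rewrite addnA.
rewrite -(wcast_ctr e1) (wcast_trans _ _ e) (wcast_trans _ _ e).
by congr (ctr _ _ _); apply: val_inj.
Qed.

End InternalEnd.

(* Main.v *)
Require Import Defs.
From mathcomp Require Import all_boot all_order all_fingroup all_algebra.
Import GRing.Theory.
Local Open Scope ring_scope.

(** Left multiplication by [a] in [A n] is a morphism of wheelspaces from [A]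
    to its [n]-fold shift, because the product of a wheelgebra is equivariant
    and compatible with contractions in its right factor; it depends on [a] as
    a morphism of wheelspaces does, because the same holds in the left factor
    ([mubar]).  Associativity and the left unit law say that this left regular
    representation is a morphism of wheelgebras, and the right unit law says
    that [a] is recovered as the value of its left multiplication at the unit
    ([mubar_inj]), hence the representation is a monomorphism.

    Admissibility is a statement about the product [abc] of three elements of
    weight 1, with outputs and inputs numbered from 0.  As contractions inside
    one factor of a product may be taken after the product, both ways of
    bracketing contract the output 1 with the input 0 (joining [a] and [b])
    and the output 2 with the input 1 (joining [b] and [c]), in opposite
    orders.  The exchange rule for successive contractions identifies the two
    results. *)

Section LeftRegular.
Variables (k : fieldType) (A : wheelgebra k).

(* The permutations of the shift are [bsum 1 s]: the equivariance laws of the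
   product apply once [a] is written as the action of the identity on [a], and
   symmetrically for [b] when permutations act on the left factor. *)
Section LeftMultiplication.
Variables (n : nat) (a : A n).

Fact lmul_lact m (s : 'S_m) (b : A m) :
  wmul a (lact s b) = lact s (wmul a b : sh n A m).
Proof. by rewrite -[a in LHS]lact1 wmul_lact. Qed.

Fact lmul_ract m (s : 'S_m) (b : A m) :
  wmul a (Defs.ract b s) = Defs.ract (wmul a b : sh n A m) s.
Proof. by rewrite -[a in LHS]ract1 wmul_ract. Qed.

Fact lmul_ctr m (j i : 'I_m.+1) (b : A m.+1) :
  wmul a (ctr j i b) = ctr j i (wmul a b : sh n A m.+1).
Proof. by rewrite -ctr_wmulr. Qed.

Definition lmul : whom A (sh n A) :=
  @Whom k A (sh n A) (fun m b => wmul a b)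
    (fun m => @wmul_linearr k A n m a) lmul_lact lmul_ract lmul_ctr.

End LeftMultiplication.

Fact lmul_linear n : linear (@lmul n : A n -> ihom A A n).
Proof. by move=> c a a'; apply: whomP => m b; apply: wmul_linearl. Qed.

Fact lmul_lactl n (s : 'S_n) (a : A n) :
  lmul n (lact s a) = lact s (lmul n a : ihom A A n).
Proof. by apply: whomP => m b; rewrite /= -[b in LHS]lact1 wmul_lact. Qed.

Fact lmul_ractl n (s : 'S_n) (a : A n) :
  lmul n (Defs.ract a s) = Defs.ract (lmul n a : ihom A A n) s.
Proof. by apply: whomP => m b; rewrite /= -[b in LHS]ract1 wmul_ract. Qed.

Fact lmul_ctrl n (j i : 'I_n.+1) (a : A n.+1) :
  lmul n (ctr j i a) = ctr j i (lmul n.+1 a : ihom A A n.+1).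
Proof. by apply: whomP => m b; rewrite /= ctr_wmull. Qed.

Definition mubar : whom A (iend A) :=
  @Whom k A (iend A) lmul lmul_linear lmul_lactl lmul_ractl lmul_ctrl.

(** The right unit law makes evaluation at the unit a retraction of [mubar n],
    up to the identification of [A (n + 0)] with [A n]. *)
Lemma mubar_inj n : injective (mubar n).
Proof.
move=> a a'.
move=> /(congr1 (fun f : whom A (sh n A) => f 0%N (wone A))) /= aa'.
by rewrite -[a]wmul1r -[a']wmul1r aa'.
Qed.

Lemma mubar_morphism : is_wheelgebra_morphism mubar.
Proof.
split=> [n m a b|]; apply: whomP => p c; first by rewrite /= wmulA.
exact: wmul1l.
Qed.

End LeftRegular.

Lemma inj_wmono (k : fieldType) (S T : wheelspace k) (h : whom S T) :
  (forall n, injective (h n)) -> wmono h.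
Proof.
move=> h_inj U f g hfg; apply: whomP => n u; apply: h_inj.
exact: (congr1 (fun q : whom U T => q n u) hfg).
Qed.

(** Contracting the same position number twice removes two adjacent letters,
    [i] and then [i + 1]; they may equally be removed from the right. *)
Lemma exch_diag n (i : 'I_n.+1) (h : 'I_n.+2) :
  h = i :> nat -> exch i h = (i, lift ord0 i).
Proof.
by move=> hi; rewrite [exch i h]surjective_pairing; congr pair; apply: val_inj;
  rewrite /= ?exchE1 ?exchE2 hi ltnn.
Qed.

(** Both bracketings are double contractions of [abc]: the right one first
    joins the input 1 of [b] to the output 2 of [c], and the left one contracts
    the output 1 with the input 0 twice, since joining [a] to [b] lowers the
    numbers of the output of [c] and of the input of [b] by one. *)
Lemma wheelgebra_admissible (k : fieldType) (A : wheelgebra k) : admissible A.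
Proof.
move=> a b c.
rewrite -(ctr_wmulr (lift ord0 ord0) ord0 a (wmul b c : A 2)).
rewrite -(ctr_wmull (lift ord0 ord0) ord0 (wmul a b : A 2) c).
(* The remaining cast is along a proof of [3 = 3], like the one in [wmulA]. *)
rewrite (_ : wcast _ _ = wmul (wmul a b) c); last first.
  by rewrite -wmulA; congr wcast; apply: eq_irrelevance.
rewrite [RHS]ctr_ctr !exch_diag //.
by congr (ctr _ _ (@ctr _ _ 2 _ _ _)); apply: val_inj.
Qed.

Theorem lemma4p35 (k : fieldType) (hk : [pchar k] =i pred0)
    (A : wheelgebra k) :
  (exists mubar : whom A (iend A),
    [/\ forall (n : nat) (a : A n) (m : nat) (b : A m),
           (mubar n a : whom A (sh n A)) m b = wmul a b,
        wmono mubar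
      & is_wheelgebra_morphism mubar]) /\
  admissible A.
Proof.
split; last exact: wheelgebra_admissible.
exists (mubar _ A); split=> //; first exact/inj_wmono/mubar_inj.
exact: mubar_morphism.
Qed.
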